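(* $\mathsf{LC}$ is decidable: there is an algorithm deciding, for any modal proposition $A$, whether $\mathsf{LC}\vdash A$.
   Context: Modal language: propositional variables, $\bot$, $\wedge,\vee,\to$, $\Box$. $\mathsf{iGL}$: intuitionistic propositional logic in the modal language plus $\Box(A\to B)\to(\Box A\to\Box B)$, $\Box A\to\Box\Box A$, $\Box(\Box A\to A)\to\Box A$, closed under modus ponens and necessitation. $\mathsf{LC}:=\mathsf{iGL}+\{A\to\Box A\}$. *)

(* Defs.v *)
From Stdlib Require Import List Arith.
Import ListNotations.

Inductive form : Type :=
| Var : nat -> form
| Bot : form
| And : form -> form -> form
| Or  : form -> form -> form
| Imp : form -> form -> form
| Box : form -> form.

(** * The logic LC = iGL + {A -> Box A}, as a Hilbert system.
    IPC part: a standard Hilbert axiomatization of intuitionistic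
    propositional logic, taken as axiom schemes over the modal language
    (so all substitution instances of IPC theorems are derivable). *)
Inductive LC_prov : form -> Prop :=
| ax_K    : forall A B, LC_prov (Imp A (Imp B A))
| ax_S    : forall A B C,
    LC_prov (Imp (Imp A (Imp B C)) (Imp (Imp A B) (Imp A C)))
| ax_andE1 : forall A B, LC_prov (Imp (And A B) A)
| ax_andE2 : forall A B, LC_prov (Imp (And A B) B)
| ax_andI  : forall A B, LC_prov (Imp A (Imp B (And A B)))
| ax_orI1  : forall A B, LC_prov (Imp A (Or A B))
| ax_orI2  : forall A B, LC_prov (Imp B (Or A B))
| ax_orE   : forall A B C,
    LC_prov (Imp (Imp A C) (Imp (Imp B C) (Imp (Or A B) C)))
| ax_efq   : forall A, LC_prov (Imp Bot A)
| ax_boxK  : forall A B, LC_prov (Imp (Box (Imp A B)) (Imp (Box A) (Box B)))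
| ax_box4  : forall A, LC_prov (Imp (Box A) (Box (Box A)))
| ax_lob   : forall A, LC_prov (Imp (Box (Imp (Box A) A)) (Box A))
| ax_LC    : forall A, LC_prov (Imp A (Box A))
| r_mp     : forall A B, LC_prov (Imp A B) -> LC_prov A -> LC_prov B
| r_nec    : forall A, LC_prov A -> LC_prov (Box A).

Inductive rf : Type :=
| rZero : rf
| rSucc : rf
| rProj : nat -> rf
| rComp : rf -> list rf -> rf
| rPrec : rf -> rf -> rf
| rMu   : rf -> rf.

Inductive eval : rf -> list nat -> nat -> Prop :=
| ev_zero : forall v, eval rZero v 0
| ev_succ : forall x v, eval rSucc (x :: v) (S x)
| ev_proj : forall i v, i < length v -> eval (rProj i) v (nth i v 0)
| ev_comp : forall f gs v w y,
    evals gs v w -> eval f w y -> eval (rComp f gs) v y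
| ev_prec0 : forall f g v y, eval f v y -> eval (rPrec f g) (0 :: v) y
| ev_precS : forall f g n v y z,
    eval (rPrec f g) (n :: v) y -> eval g (n :: y :: v) z ->
    eval (rPrec f g) (S n :: v) z
| ev_mu : forall f v n,
    eval f (n :: v) 0 ->
    (forall m, m < n -> exists k, eval f (m :: v) (S k)) ->
    eval (rMu f) v n
with evals : list rf -> list nat -> list nat -> Prop :=
| evs_nil : forall v, evals [] v []
| evs_cons : forall g gs v y ys,
    eval g v y -> evals gs v ys -> evals (g :: gs) v (y :: ys).

(** * Goedel numbering of formulas (Cantor pairing; injective). *)
Definition cpair (x y : nat) : nat := (x + y) * (x + y + 1) / 2 + y.

Fixpoint encode (A : form) : nat :=
  match A with
  | Var n => cpair 0 n
  | Bot => cpair 1 0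
  | And A B => cpair 2 (cpair (encode A) (encode B))
  | Or A B => cpair 3 (cpair (encode A) (encode B))
  | Imp A B => cpair 4 (cpair (encode A) (encode B))
  | Box A => cpair 5 (encode A)
  end.

Definition decidable_form (P : form -> Prop) : Prop :=
  exists p : rf, forall A : form,
    (P A -> eval p [encode A] 1) /\ (~ P A -> eval p [encode A] 0).

(* Main.v *)
(** LC has the finite model property with a computable bound: if [A] is not
    provable, it fails in a model whose worlds are prime theories restricted to
    the formulas of code at most [encode A], ordered by inclusion, where [v] is
    a modal successor of [w] when [w] is included in [v], [v] contains [B] for
    every [Box B] in [w], and [v] contains some boxed formula that [w] lacks.
    Coding sets of codes as bitmasks, and sets of worlds as bitmasks of
    bitmasks, the existence of such a model is a statement with bounded
    quantifiers only, hence decided by a primitive recursive function. *)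
From Stdlib Require Import List Arith Bool Lia Classical Cantor.
Require Import Defs.
Import ListNotations.

(** * Computable functions *)

(** Programs carry no arity, so agreement with [f] is required only on lists of length [k];
    elsewhere [f] may rely on defaults such as that of [hd 0]. *)
Definition comp (k : nat) (f : list nat -> nat) : Prop :=
  exists p, forall v, length v = k -> eval p v (f v).

Definition compb (k : nat) (P : list nat -> bool) : Prop :=
  comp k (fun v => Nat.b2n (P v)).

Lemma comp_ext k f g : (forall v, f v = g v) -> comp k f -> comp k g.
Proof.
  intros E [p Hp]. exists p. intros v Hv. rewrite <- E. auto.
Qed.

Lemma compb_ext k P Q : (forall v, P v = Q v) -> compb k P -> compb k Q.
Proof.
  intros E. apply comp_ext. intros v. now rewrite E.
Qed.

(** Passes the current arguments on to a subprogram while dropping a prefix such as a counter or an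
    accumulator. *)
Lemma evals_projs u v :
  evals (map rProj (seq (length u) (length v))) (u ++ v) v.
Proof.
  revert u. induction v as [|x v IH]; intros u; cbn; constructor.
  - replace x with (nth (length u) (u ++ x :: v) 0) at 2 by apply nth_middle.
    constructor. rewrite length_app. cbn. lia.
  - specialize (IH (u ++ [x])).
    rewrite length_app, <- app_assoc, Nat.add_comm in IH. exact IH.
Qed.

Lemma comp_tl k f : comp k f -> comp (S k) (fun v => f (tl v)).
Proof.
  intros [p Hp]. exists (rComp p (map rProj (seq 1 k))).
  intros [|x v] Hv; [discriminate|]. injection Hv as <-.
  econstructor; [exact (evals_projs [x] v)|]. now apply Hp.
Qed.

(** Recursion and bounded quantifiers push their bound variable to the front of the list, so
    variables show up as de Bruijn indices, in the form of iterated tails. *)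
Lemma comp_var k i : i < k -> comp k (fun v => hd 0 (Nat.iter i (@tl nat) v)).
Proof.
  intros Hi. exists (rProj i). intros v Hv.
  replace (hd 0 (Nat.iter i (@tl nat) v)) with (nth i v 0).
  - constructor. lia.
  - clear. revert v. induction i as [|i IH]; intros v; [now destruct v|].
    rewrite Nat.iter_succ_r, <- IH. destruct v; [now destruct i|reflexivity].
Qed.

Lemma comp_zero k : comp k (fun _ => 0).
Proof. exists rZero. constructor. Qed.

Lemma comp_succ k f : comp k f -> comp k (fun v => S (f v)).
Proof.
  intros [p Hp]. exists (rComp rSucc [p]). intros v Hv.
  repeat econstructor. auto.
Qed.

Lemma comp_rec k n b s :
  comp k n -> comp k b ->
  comp (S (S k)) (fun u => s (hd 0 u) (hd 0 (tl u)) (tl (tl u))) ->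
  comp k (fun v => nat_rect (fun _ => nat) (b v) (fun i y => s i y v) (n v)).
Proof.
  intros [pn Hn] [pb Hb] [ps Hs].
  exists (rComp (rPrec pb ps) (pn :: map rProj (seq 0 k))). intros v <-.
  econstructor.
  - constructor; [now apply Hn|exact (evals_projs [] v)].
  - induction (n v) as [|m IH]; cbn.
    + constructor. now apply Hb.
    + econstructor; [exact IH|].
      now apply (Hs (m :: _ :: v)); cbn; f_equal; f_equal.
Qed.

Lemma comp_const k c : comp k (fun _ => c).
Proof. induction c; [apply comp_zero|now apply comp_succ]. Qed.

Lemma comp_add k f g : comp k f -> comp k g -> comp k (fun v => f v + g v).
Proof.
  intros Hf Hg.
  apply comp_ext with
    (fun v => nat_rect (fun _ => nat) (g v) (fun _ y => S y) (f v)).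
  - intros v. induction (f v); cbn; congruence.
  - apply comp_rec with (s := fun _ y _ => S y); auto.
    apply comp_succ, (comp_var _ 1). lia.
Qed.

Lemma comp_mul k f g : comp k f -> comp k g -> comp k (fun v => f v * g v).
Proof.
  intros Hf Hg.
  apply comp_ext with
    (fun v => nat_rect (fun _ => nat) 0 (fun _ y => g v + y) (f v)).
  - intros v. induction (f v); cbn; congruence.
  - apply comp_rec with (s := fun _ y v => g v + y);
      [assumption|apply comp_zero|].
    apply comp_add; [exact (comp_tl _ _ (comp_tl _ _ Hg))|].
    apply (comp_var _ 1). lia.
Qed.

Lemma comp_pow2 k f : comp k f -> comp k (fun v => 2 ^ f v).
Proof.
  intros Hf.
  apply comp_ext with
    (fun v => nat_rect (fun _ => nat) 1 (fun _ y => y + y) (f v)).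
  - intros v. induction (f v) as [|n IH]; cbn; [reflexivity|].
    rewrite IH. lia.
  - apply comp_rec with (s := fun _ y _ => y + y);
      [assumption|apply comp_const|].
    apply comp_add; apply (comp_var _ 1); lia.
Qed.

Lemma compb_negb k P : compb k P -> compb k (fun v => negb (P v)).
Proof.
  intros HP.
  (* Recursion with a constant step is a test for zero. *)
  apply comp_ext with
    (fun v => nat_rect (fun _ => nat) 1 (fun _ _ => 0) (Nat.b2n (P v))).
  - intros v. now destruct (P v).
  - apply comp_rec with (s := fun _ _ _ => 0);
      [assumption|apply comp_const|apply comp_const].
Qed.

Lemma compb_andb k P Q :
  compb k P -> compb k Q -> compb k (fun v => P v && Q v).
Proof.
  intros HP HQ.
  apply comp_ext with (fun v => Nat.b2n (P v) * Nat.b2n (Q v)).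
  - intros v. now destruct (P v), (Q v).
  - now apply comp_mul.
Qed.

Lemma compb_orb k P Q :
  compb k P -> compb k Q -> compb k (fun v => P v || Q v).
Proof.
  intros HP HQ.
  apply compb_ext with (fun v => negb (negb (P v) && negb (Q v))).
  - intros v. now destruct (P v), (Q v).
  - now apply compb_negb, compb_andb; apply compb_negb.
Qed.

Lemma compb_implb k P Q :
  compb k P -> compb k Q -> compb k (fun v => implb (P v) (Q v)).
Proof.
  intros HP HQ.
  apply compb_ext with (fun v => negb (P v) || Q v).
  - intros v. now destruct (P v), (Q v).
  - now apply compb_orb; [apply compb_negb|].
Qed.

Lemma compb_eqb k P Q :
  compb k P -> compb k Q -> compb k (fun v => eqb (P v) (Q v)).
Proof.
  intros HP HQ.
  apply compb_ext with (fun v => implb (P v) (Q v) && implb (Q v) (P v)).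
  - intros v. now destruct (P v), (Q v).
  - now apply compb_andb; apply compb_implb.
Qed.

Lemma compb_forallb k n P :
  comp k n -> compb (S k) (fun u => P (hd 0 u) (tl u)) ->
  compb k (fun v => forallb (fun i => P i v) (seq 0 (n v))).
Proof.
  intros Hn [p Hp].
  (* A running product of truth values computes the conjunction. *)
  apply comp_ext with
    (fun v => nat_rect (fun _ => nat) 1
                (fun i y => y * Nat.b2n (P i v)) (n v)).
  - intros v. induction (n v) as [|m IH]; [reflexivity|].
    rewrite seq_S, forallb_app. cbn. rewrite IH, andb_true_r.
    now destruct (forallb _ _), (P m v).
  - apply comp_rec with (s := fun i y v => y * Nat.b2n (P i v));
      [assumption|apply comp_const|].
    apply comp_mul; [apply (comp_var _ 1); lia|].
    (* The step receives counter, accumulator and parameters; [P] must not see the accumulator, so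
       position 1 is skipped. *)
    exists (rComp p (rProj 0 :: map rProj (seq 2 k))).
    intros [|i [|y v]] Hv; try discriminate. injection Hv as <-.
    apply ev_comp with (i :: v).
    + constructor; [apply (ev_proj 0); cbn; lia|].
      exact (evals_projs [i; y] v).
    + now apply (Hp (i :: v)); cbn.
Qed.

Lemma compb_existsb k n P :
  comp k n -> compb (S k) (fun u => P (hd 0 u) (tl u)) ->
  compb k (fun v => existsb (fun i => P i v) (seq 0 (n v))).
Proof.
  intros Hn HP.
  apply compb_ext with
    (fun v => negb (forallb (fun i => negb (P i v)) (seq 0 (n v)))).
  - intros v. induction (seq 0 (n v)) as [|i l IH]; [reflexivity|].
    cbn. rewrite <- IH. now destruct (P i v).
  - apply compb_negb.
    apply compb_forallb with (P := fun i v => negb (P i v)); [assumption|].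
    now apply compb_negb.
Qed.

Lemma compb_odd k f : comp k f -> compb k (fun v => Nat.odd (f v)).
Proof.
  intros Hf.
  (* Each successor flips the parity; the inner recursion is the flip. *)
  apply comp_ext with
    (fun v => nat_rect (fun _ => nat) 0
                (fun _ y => nat_rect (fun _ => nat) 1 (fun _ _ => 0) y) (f v)).
  - intros v. induction (f v) as [|n IH]; [reflexivity|].
    rewrite Nat.odd_succ, <- Nat.negb_odd. cbn. rewrite IH.
    now destruct (Nat.odd n).
  - apply comp_rec with
      (s := fun _ y _ => nat_rect (fun _ => nat) 1 (fun _ _ => 0) y);
      [assumption|apply comp_zero|].
    apply comp_rec with (b := fun _ => 1) (s := fun _ _ _ => 0);
      [apply (comp_var _ 1); lia|apply comp_const|apply comp_const].
Qed.

Lemma comp_div2 k f : comp k f -> comp k (fun v => Nat.div2 (f v)).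
Proof.
  intros Hf.
  (* Half of a number, rounded down, counts the odd numbers below it. *)
  apply comp_ext with
    (fun v => nat_rect (fun _ => nat) 0
                (fun i y => y + Nat.b2n (Nat.odd i)) (f v)).
  - intros v. induction (f v) as [|n IH]; [reflexivity|].
    cbn [nat_rect]. rewrite IH.
    pose proof (Nat.div2_odd n). pose proof (Nat.div2_odd (S n)) as H1.
    rewrite Nat.odd_succ, <- Nat.negb_odd in H1.
    destruct (Nat.odd n); cbn [Nat.b2n negb] in *; lia.
  - apply comp_rec with (s := fun i y _ => y + Nat.b2n (Nat.odd i));
      [assumption|apply comp_zero|].
    apply comp_add; [apply (comp_var _ 1); lia|].
    apply compb_odd, (comp_var _ 0). lia.
Qed.

Lemma compb_testbit k f g :
  comp k f -> comp k g -> compb k (fun v => Nat.testbit (f v) (g v)).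
Proof.
  intros Hf Hg.
  (* Shift right [g v] times, then read the lowest bit. *)
  apply compb_ext with
    (fun v => Nat.odd (nat_rect (fun _ => nat) (f v)
                         (fun _ y => Nat.div2 y) (g v))).
  - intros v. generalize (f v). induction (g v) as [|n IH]; [reflexivity|].
    intros a. cbn [Nat.testbit]. rewrite <- IH. f_equal.
    clear. induction n; cbn in *; congruence.
  - apply compb_odd, comp_rec with (s := fun _ y _ => Nat.div2 y); auto.
    apply comp_div2, (comp_var _ 1). lia.
Qed.

Lemma comp_cpair k f g :
  comp k f -> comp k g -> comp k (fun v => cpair (f v) (g v)).
Proof.
  intros Hf Hg. unfold cpair.
  apply comp_add; [|assumption].
  apply comp_ext with
    (fun v => Nat.div2 ((f v + g v) * (f v + g v + 1)));
    [intros v; apply Nat.div2_div|].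
  apply comp_div2, comp_mul; repeat apply comp_add; auto using comp_const.
Qed.

(** * Kripke semantics *)

Section Kripke.
Variables (T : Type) (le R : T -> T -> Prop) (val : nat -> T -> Prop).
Hypothesis le_refl : forall w, le w w.
Hypothesis le_trans : forall u v w, le u v -> le v w -> le u w.
Hypothesis R_le : forall w v, R w v -> le w v.
Hypothesis le_R : forall u v w, le u v -> R v w -> R u w.
Hypothesis R_wf : well_founded (fun v w => R w v).
Hypothesis val_le : forall n w v, le w v -> val n w -> val n v.

Fixpoint forces (w : T) (A : form) : Prop :=
  match A with
  | Var n => val n w
  | Bot => False
  | And A B => forces w A /\ forces w B
  | Or A B => forces w A \/ forces w B
  | Imp A B => forall v, le w v -> forces v A -> forces v B
  | Box A => forall v, R w v -> forces v A
  end.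

Lemma forces_le A w v : le w v -> forces w A -> forces v A.
Proof.
  revert w v. induction A; cbn; intros w v L H; eauto.
  - destruct H; eauto.
  - destruct H; eauto.
Qed.

(** Persistence along [le], and hence along [R] by [R_le], validates [ax_LC]; converse
    well-foundedness of [R] validates Löb's axiom. *)
Lemma LC_sound A : LC_prov A -> forall w, forces w A.
Proof.
  induction 1; cbn; intros w; try tauto; try (intuition eauto; fail).
  all: intros; eauto using forces_le.
  - (* Löb: induction along the converse of [R] *)
    rename v into u, v0 into v, H0 into Hu, H1 into Huv.
    induction v as [v IH] using (well_founded_induction R_wf).
    apply (Hu v Huv v (le_refl v)). intros x Hx. apply IH; eauto.
  - exact (IHLC_prov1 w w (le_refl w) (IHLC_prov2 w)).
Qed.

End Kripke.

(** * Derivability from hypotheses and saturation *)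

(** Necessitation enters only through theorems of the logic, so modus ponens is the sole rule that
    the deduction theorem has to handle. *)
Inductive drv (G : form -> Prop) : form -> Prop :=
| drv_hyp A : G A -> drv G A
| drv_thm A : LC_prov A -> drv G A
| drv_mp A B : drv G (Imp A B) -> drv G A -> drv G B.

Definition add (G : form -> Prop) (A : form) : form -> Prop :=
  fun B => G B \/ B = A.

Lemma drv_cut G D A : (forall B, G B -> drv D B) -> drv G A -> drv D A.
Proof. induction 2; eauto using drv. Qed.

Lemma drv_mono (G D : form -> Prop) A :
  (forall B, G B -> D B) -> drv G A -> drv D A.
Proof. intros H. apply drv_cut. intros B HB. now apply drv_hyp, H. Qed.

Lemma drv_closed A : drv (fun _ => False) A -> LC_prov A.
Proof. induction 1; [contradiction|assumption|eauto using r_mp]. Qed.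

Lemma drv_weaken G A B : drv G B -> drv G (Imp A B).
Proof. apply drv_mp, drv_thm, ax_K. Qed.

Lemma drv_deduction G A B : drv (add G A) B -> drv G (Imp A B).
Proof.
  induction 1 as [B [H| ->]|B H|B C _ IH1 _ IH2].
  - now apply drv_weaken, drv_hyp.
  - apply drv_thm. eapply r_mp; [|apply (ax_K A A)].
    eapply r_mp; [apply ax_S|apply ax_K].
  - now apply drv_weaken, drv_thm.
  - eapply drv_mp; [|exact IH2].
    eapply drv_mp; [apply drv_thm, ax_S|exact IH1].
Qed.

(** A derivation can be boxed line by line: theorems by necessitation, modus ponens by [ax_boxK]. *)
Lemma drv_box G D A :
  (forall B, G B -> drv D (Box B)) -> drv G A -> drv D (Box A).
Proof.
  intros H. induction 1 as [B HB|B HB|B C _ IH1 _ IH2].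
  - auto.
  - now apply drv_thm, r_nec.
  - eapply drv_mp; [|exact IH2].
    eapply drv_mp; [apply drv_thm, ax_boxK|exact IH1].
Qed.

(** * Coding of formulas and saturated theories *)

Local Arguments cpair : simpl never.

Lemma cpair_to_nat x y : cpair x y = Cantor.to_nat (x, y).
Proof.
  unfold cpair. pose proof (Cantor.to_nat_spec x y) as H.
  enough ((x + y) * (x + y + 1) / 2 = Cantor.to_nat (x, y) - y) as ->.
  - pose proof (Cantor.to_nat_non_decreasing x y). lia.
  - symmetry. apply Nat.div_unique with 0; lia.
Qed.

Lemma cpair_inj x y x' y' : cpair x y = cpair x' y' -> x = x' /\ y = y'.
Proof.
  rewrite !cpair_to_nat. intros H. apply Cantor.to_nat_inj in H.
  now injection H.
Qed.

(** Consequently the formulas of code at most [a] are closed under subformulas. *)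
Lemma cpair_le x y : x + y <= cpair x y.
Proof.
  rewrite cpair_to_nat. pose proof (Cantor.to_nat_non_decreasing x y). lia.
Qed.

Lemma encode_inj A B : encode A = encode B -> A = B.
Proof.
  revert B. induction A; intros []; cbn; intros H;
    apply cpair_inj in H as [H1 H2]; try discriminate;
    try apply cpair_inj in H2 as [H2 H3]; f_equal; auto.
Qed.

(** The bounded form of a prime theory, presented by maximality: adding any further formula within
    the bound would make [B] derivable. Deductive closure and primeness follow below. *)
Definition saturated (a : nat) (G : form -> Prop) : Prop :=
  (forall C, G C -> encode C <= a) /\
  exists B, ~ drv G B /\
    forall C, encode C <= a -> G C \/ drv G (Imp C B).

(** Only finitely many formulas lie within the bound, so they are treated one by one in the order of
    their codes, each being added if [B] stays underivable. *)
Lemma lindenbaum a G B :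
  (forall C, G C -> encode C <= a) -> ~ drv G B ->
  exists D, saturated a D /\ (forall C, G C -> D C) /\ ~ drv D B.
Proof.
  intros Ha HB.
  (* At stage [n] all formulas of code below [n] have been settled. *)
  enough (forall n, n <= S a -> exists D : form -> Prop,
    (forall C, G C -> D C) /\ ~ drv D B /\
    (forall C, D C -> encode C <= a) /\
    forall C, encode C < n -> D C \/ drv D (Imp C B)) as H.
  { destruct (H (S a)) as (D & H1 & H2 & H3 & H4); [lia|].
    exists D. repeat split; auto. exists B. split; [assumption|].
    intros C HC. apply H4. lia. }
  induction n as [|n IH]; intros Hn.
  - exists G. repeat split; auto. lia.
  - destruct IH as (D & H1 & H2 & H3 & H4); [lia|].
    destruct (classic (exists C, encode C = n /\ ~ drv (add D C) B))
      as [(C & EC & HC)|N].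
    + exists (add D C). split; [|split; [assumption|split]].
      * left. auto.
      * intros E [HE| ->]; [auto|lia].
      * intros E HE. destruct (Nat.eq_dec (encode E) n) as [EE|].
        -- left. right. apply encode_inj. congruence.
        -- destruct (H4 E); [lia|now left; left|right].
           eapply drv_mono; [|eassumption]. now left.
    + exists D. repeat split; auto. intros E HE.
      destruct (Nat.eq_dec (encode E) n) as [EE|].
      (* [E] has code [n] and could not be added, so adding it proves [B]. *)
      * right. apply drv_deduction. apply NNPP. eauto.
      * apply H4. lia.
Qed.

Lemma saturated_drv a G C :
  saturated a G -> encode C <= a -> drv G C -> G C.
Proof.
  intros (_ & B & HB & H) HC D. destruct (H C HC); [assumption|].
  contradict HB. eauto using drv.
Qed.

Lemma saturated_bot a G : saturated a G -> ~ G Bot.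
Proof.
  intros (_ & B & HB & _) H. apply HB.
  eapply drv_mp; [apply drv_thm, ax_efq|now apply drv_hyp].
Qed.

Lemma saturated_or a G C D :
  saturated a G -> encode C <= a -> encode D <= a -> G (Or C D) -> G C \/ G D.
Proof.
  intros (_ & B & HB & H) HC HD HO.
  destruct (H C HC) as [|IC]; [auto|]. destruct (H D HD) as [|ID]; [auto|].
  contradict HB. eapply drv_mp; [|apply drv_hyp, HO].
  eapply drv_mp; [|exact ID]. eapply drv_mp; [|exact IC].
  apply drv_thm, ax_orE.
Qed.

(** By the deduction theorem [G] with [B] added does not prove [C], so it extends to a saturated
    theory avoiding [C]. *)
Lemma saturated_imp a G B C :
  saturated a G -> encode B <= a -> encode (Imp B C) <= a -> ~ G (Imp B C) ->
  exists D, saturated a D /\ (forall E, G E -> D E) /\ D B /\ ~ D C.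
Proof.
  intros HG HB HI N.
  destruct (lindenbaum a (add G B) C) as (D & H1 & H2 & H3).
  - intros E [HE| ->]; [now apply HG|assumption].
  - contradict N. eapply saturated_drv; eauto using drv_deduction.
  - exists D. split; [assumption|split; [|split]].
    + intros E HE. apply H2. now left.
    + apply H2. now right.
    + eauto using drv.
Qed.

(* If the successor theory proved [B], then boxing its premises and Löb's axiom
   would put [Box B] in [G]. *)
Lemma saturated_box a G B :
  saturated a G -> (forall C, encode (Box C) <= a -> encode C <= a) ->
  encode (Box B) <= a -> ~ G (Box B) ->
  exists D, saturated a D /\ (forall E, G E -> D E) /\
    (forall E, G (Box E) -> D E) /\ D (Box B) /\ ~ D B.
Proof.
  intros HG Hsub HB N.
  destruct (lindenbaum a (add (fun E => G E \/ G (Box E)) (Box B)) B)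
    as (D & H1 & H2 & H3).
  - intros E [[HE|HE]| ->]; [|apply Hsub|assumption]; now apply HG.
  - contradict N. eapply saturated_drv; eauto.
    eapply drv_mp; [apply drv_thm, ax_lob|].
    apply drv_deduction in N. revert N. apply drv_box.
    (* A premise [E] with [Box E] in [G] has its box at hand; one from [G] itself is boxed by
       [ax_LC]. *)
    intros E [HE|HE]; [|now apply drv_hyp].
    eapply drv_mp; [apply drv_thm, ax_LC|now apply drv_hyp].
  - exists D. unfold add in H2. split; [assumption|].
    repeat split; auto. eauto using drv.
Qed.

(** * Finite models as numbers *)

Definition sub (a w v : nat) : bool :=
  forallb (fun i => implb (Nat.testbit w i) (Nat.testbit v i)) (seq 0 (S a)).

(** The last conjunct makes every step a proper inclusion, which is what gives converse
    well-foundedness. *)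
Definition acc (a w v : nat) : bool :=
  sub a w v &&
  forallb (fun b => implb (Nat.testbit w (cpair 5 b)) (Nat.testbit v b))
    (seq 0 (S a)) &&
  existsb
    (fun b => Nat.testbit v (cpair 5 b) && negb (Nat.testbit w (cpair 5 b)))
    (seq 0 (S a)).

(* [X] is a subformula-closed set of codes and [W] the set of worlds; a world
   is identified with the set of codes of formulas true in it. *)
Definition local_truth (a X W w b c : nat) : bool :=
  negb (Nat.testbit w (cpair 1 0)) &&
  implb (Nat.testbit X (cpair 2 (cpair b c)))
    (Nat.testbit X b && Nat.testbit X c &&
     eqb (Nat.testbit w (cpair 2 (cpair b c)))
       (Nat.testbit w b && Nat.testbit w c)) &&
  implb (Nat.testbit X (cpair 3 (cpair b c)))
    (Nat.testbit X b && Nat.testbit X c &&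
     eqb (Nat.testbit w (cpair 3 (cpair b c)))
       (Nat.testbit w b || Nat.testbit w c)) &&
  implb (Nat.testbit X (cpair 4 (cpair b c)))
    (Nat.testbit X b && Nat.testbit X c &&
     eqb (Nat.testbit w (cpair 4 (cpair b c)))
       (forallb
          (fun v => implb (Nat.testbit W v && sub a w v && Nat.testbit v b)
                      (Nat.testbit v c)) (seq 0 (2 ^ S a)))) &&
  implb (Nat.testbit X (cpair 5 b))
    (Nat.testbit X b &&
     eqb (Nat.testbit w (cpair 5 b))
       (forallb
          (fun v => implb (Nat.testbit W v && acc a w v) (Nat.testbit v b))
          (seq 0 (2 ^ S a)))).

Definition countermodel (a X W : nat) : bool :=
  Nat.testbit X a &&
  forallb
    (fun w => implb (Nat.testbit W w)
       (forallb (fun b => forallb (fun c => local_truth a X W w b c)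
          (seq 0 (S a))) (seq 0 (S a))))
    (seq 0 (2 ^ S a)) &&
  existsb (fun w => Nat.testbit W w && negb (Nat.testbit w a))
    (seq 0 (2 ^ S a)).

(** Codes at most [a] occupy [S a] bits, so sets of codes are numbers below [2 ^ S a], and sets of
    worlds are numbers below [2 ^ (2 ^ S a)]. *)
Definition refutable (a : nat) : bool :=
  existsb
    (fun X => existsb (fun W => countermodel a X W) (seq 0 (2 ^ (2 ^ S a))))
    (seq 0 (2 ^ S a)).

(** Follows the syntax of the boolean expression. The patterns [@?P i v] recover the body of a
    bounded quantifier as a function of the bound index and the argument list; what remains are
    variables and constants. *)
Ltac comp_step :=
  lazymatch goal with
  | |- compb _ (fun v => negb _) => apply compb_negb
  | |- compb _ (fun v => andb _ _) => apply compb_andb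
  | |- compb _ (fun v => orb _ _) => apply compb_orb
  | |- compb _ (fun v => implb _ _) => apply compb_implb
  | |- compb _ (fun v => eqb _ _) => apply compb_eqb
  | |- compb _ (fun v => Nat.testbit _ _) => apply compb_testbit
  | |- compb ?k (fun v => forallb (fun i => @?P i v) (seq 0 (@?n v))) =>
      apply (compb_forallb k n (fun i v => P i v))
  | |- compb ?k (fun v => existsb (fun i => @?P i v) (seq 0 (@?n v))) =>
      apply (compb_existsb k n (fun i v => P i v))
  | |- comp _ (fun v => S _) => apply comp_succ
  | |- comp _ (fun v => 2 ^ _) => apply comp_pow2
  | |- comp _ (fun v => cpair _ _) => apply comp_cpair
  | |- comp _ (hd 0) => apply (comp_var _ 0); lia
  | |- comp _ (fun v => hd 0 _) =>
      first [ apply (comp_var _ 0) | apply (comp_var _ 1)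
            | apply (comp_var _ 2) | apply (comp_var _ 3)
            | apply (comp_var _ 4) | apply (comp_var _ 5)
            | apply (comp_var _ 6) ]; lia
  | |- comp _ (fun v => _) => apply comp_const
  end.

Lemma compb_refutable : compb 1 (fun v => refutable (hd 0 v)).
Proof.
  unfold refutable, countermodel, local_truth, acc, sub.
  repeat (comp_step; cbv beta).
Qed.

(** * Bitmasks as finite sets *)

Notation bit w i := (Nat.testbit w i = true).

Lemma bit_lt w n i : w < 2 ^ n -> bit w i -> i < n.
Proof.
  revert w i. induction n as [|n IH]; intros w i Hw H.
  - replace w with 0 in H by (cbn in Hw; lia).
    now rewrite Nat.bits_0 in H.
  - destruct i as [|i]; [lia|]. apply -> Nat.succ_lt_mono.
    apply (IH (Nat.div2 w)); [|exact H].
    pose proof (Nat.div2_odd w). cbn in Hw. lia.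
Qed.

(** Halving both numbers preserves inclusion, and the lowest bits are compared separately. *)
Lemma bit_incl_le w v : (forall i, bit w i -> bit v i) -> w <= v.
Proof.
  revert v. induction w as [w IH] using lt_wf_ind. intros v H.
  destruct (Nat.eq_dec w 0) as [->|]; [lia|].
  pose proof (Nat.div2_odd w) as Ew. pose proof (Nat.div2_odd v) as Ev.
  assert (Nat.div2 w <= Nat.div2 v).
  { apply IH; [apply Nat.lt_div2; lia|]. intros i. apply (H (S i)). }
  specialize (H 0). rewrite !Nat.bit0_odd in H.
  destruct (Nat.odd w); [rewrite H in Ev by reflexivity|];
    cbn [Nat.b2n] in *; lia.
Qed.

(** [P] need not be decidable: excluded middle fixes bit 0, and the mask of the shifted property
    supplies the other bits. *)
Lemma bit_comprehension n (P : nat -> Prop) :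
  exists w, w < 2 ^ n /\ forall i, bit w i <-> i < n /\ P i.
Proof.
  revert P. induction n as [|n IH]; intros P.
  - exists 0. split; [cbn; lia|]. intros i. rewrite Nat.bits_0.
    split; [discriminate|lia].
  - destruct (IH (fun i => P (S i))) as (w & Hw & H).
    assert (exists b, b = true <-> P 0) as [b Hb].
    { destruct (classic (P 0)); [now exists true|now exists false]. }
    exists (2 * w + Nat.b2n b). split; [destruct b; cbn in *; lia|].
    intros [|i].
    + rewrite Nat.testbit_0_r, Hb. split; [split; [lia|]|]; tauto.
    + rewrite Nat.testbit_succ_r, H. split; intros []; split; auto; lia.
Qed.

(** * Logical meaning of the boolean tests *)

Lemma forallb_seq n P :
  forallb P (seq 0 n) = true <-> forall i, i < n -> P i = true.
Proof.
  rewrite forallb_forall. split; intros H i Hi; apply H.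
  - apply in_seq. lia.
  - apply in_seq in Hi. lia.
Qed.

Lemma forallb_implb n P Q :
  forallb (fun i => implb (P i) (Q i)) (seq 0 n) = true <->
  forall i, i < n -> P i = true -> Q i = true.
Proof.
  rewrite forallb_seq.
  now split; intros H i Hi; specialize (H i Hi); apply implb_true_iff.
Qed.

Lemma existsb_seq n P :
  existsb P (seq 0 n) = true <-> exists i, i < n /\ P i = true.
Proof.
  rewrite existsb_exists. split; intros (i & Hi & H); exists i; split; auto.
  - apply in_seq in Hi. lia.
  - apply in_seq. lia.
Qed.

Lemma negb_bit w i : negb (Nat.testbit w i) = true <-> ~ bit w i.
Proof. rewrite negb_true_iff. now destruct (Nat.testbit w i). Qed.

Lemma eqb_iff b c : eqb b c = true <-> (b = true <-> c = true).
Proof. now rewrite eqb_true_iff, eq_iff_eq_true. Qed.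

Lemma sub_spec a w v :
  w < 2 ^ S a -> sub a w v = true <-> forall i, bit w i -> bit v i.
Proof.
  intros Hw. unfold sub. rewrite forallb_seq.
  split; intros H i; [|intros _]; specialize (H i).
  - rewrite implb_true_iff in H. intros Hi. apply H; [|assumption].
    eauto using bit_lt.
  - now apply implb_true_iff.
Qed.

Lemma acc_spec a w v :
  w < 2 ^ S a -> v < 2 ^ S a ->
  acc a w v = true <->
  (forall i, bit w i -> bit v i) /\
  (forall b, bit w (cpair 5 b) -> bit v b) /\
  exists b, bit v (cpair 5 b) /\ ~ bit w (cpair 5 b).
Proof.
  intros Hw Hv. unfold acc.
  rewrite !andb_true_iff, sub_spec, forallb_seq, existsb_seq by assumption.
  (* A world has no bits above [a], so bounding [b] by [a] in [acc] loses nothing. *)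
  assert (forall u b, u < 2 ^ S a -> bit u (cpair 5 b) -> b < S a) as L.
  { intros u b Hu H. apply (bit_lt u (S a)) in H; [|assumption].
    pose proof (cpair_le 5 b). lia. }
  setoid_rewrite implb_true_iff. setoid_rewrite andb_true_iff.
  setoid_rewrite negb_bit. firstorder eauto.
Qed.

Local Opaque cpair sub acc.

Lemma local_truth_spec a X W w b c :
  local_truth a X W w b c = true <->
  ~ bit w (cpair 1 0) /\
  (bit X (cpair 2 (cpair b c)) -> bit X b /\ bit X c /\
     (bit w (cpair 2 (cpair b c)) <-> bit w b /\ bit w c)) /\
  (bit X (cpair 3 (cpair b c)) -> bit X b /\ bit X c /\
     (bit w (cpair 3 (cpair b c)) <-> bit w b \/ bit w c)) /\
  (bit X (cpair 4 (cpair b c)) -> bit X b /\ bit X c /\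
     (bit w (cpair 4 (cpair b c)) <->
        forall v, v < 2 ^ S a -> bit W v -> sub a w v = true ->
          bit v b -> bit v c)) /\
  (bit X (cpair 5 b) -> bit X b /\
     (bit w (cpair 5 b) <->
        forall v, v < 2 ^ S a -> bit W v -> acc a w v = true -> bit v b)).
Proof.
  unfold local_truth.
  rewrite !andb_true_iff, !implb_true_iff, negb_bit, !andb_true_iff.
  rewrite !eqb_iff, andb_true_iff, orb_true_iff.
  rewrite !forallb_implb.
  setoid_rewrite andb_true_iff. setoid_rewrite andb_true_iff.
  intuition auto; firstorder.
Qed.

Lemma countermodel_spec a X W :
  countermodel a X W = true <->
  bit X a /\
  (forall w, w < 2 ^ S a -> bit W w -> forall b, b < S a -> forall c, c < S a ->
     local_truth a X W w b c = true) /\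
  exists w, w < 2 ^ S a /\ bit W w /\ ~ bit w a.
Proof.
  unfold countermodel.
  rewrite !andb_true_iff, forallb_seq, existsb_seq.
  setoid_rewrite implb_true_iff. setoid_rewrite forallb_seq.
  setoid_rewrite forallb_seq.
  setoid_rewrite andb_true_iff. setoid_rewrite negb_bit. tauto.
Qed.

Lemma refutable_spec a :
  refutable a = true <->
  exists X W, X < 2 ^ S a /\ W < 2 ^ (2 ^ S a) /\ countermodel a X W = true.
Proof.
  unfold refutable. rewrite existsb_seq. setoid_rewrite existsb_seq.
  firstorder.
Qed.

(** * Soundness of the refutation search *)

Lemma countermodel_unprovable A X W :
  X < 2 ^ S (encode A) -> countermodel (encode A) X W = true -> ~ LC_prov A.
Proof.
  set (a := encode A). intros HX H.
  apply countermodel_spec in H as (HXA & Hloc & w0 & Hw0 & HW0 & HA) .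
  set (T := {w | w < 2 ^ S a /\ bit W w}).
  set (le := fun w v : T => forall i, bit (proj1_sig w) i -> bit (proj1_sig v) i).
  set (R := fun w v : T => acc a (proj1_sig w) (proj1_sig v) = true).
  set (val := fun n (w : T) => bit (proj1_sig w) (encode (Var n))).
  assert (forall w v, R w v <-> le w v /\
    (forall b, bit (proj1_sig w) (cpair 5 b) -> bit (proj1_sig v) b) /\
    exists b, bit (proj1_sig v) (cpair 5 b) /\
              ~ bit (proj1_sig w) (cpair 5 b)) as HR.
  { intros [w [Hw ?]] [v [Hv ?]]. now apply acc_spec. }
  (* Truth lemma: local truth only constrains codes in [X], and [X] is closed under subformulas, so
     the induction stays inside [X]. *)
  assert (forall B, bit X (encode B) ->
    forall w : T, forces T le R val w B <-> bit (proj1_sig w) (encode B))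
    as truth.
  { assert (forall w, w < 2 ^ S a -> bit W w -> forall t b c,
      bit X (cpair t (cpair b c)) -> local_truth a X W w b c = true) as L2.
    { intros w Hw HW t b c HB. apply (bit_lt _ _ _ HX) in HB.
      pose proof (cpair_le t (cpair b c)). pose proof (cpair_le b c).
      apply Hloc; auto; lia. }
    induction B as [n| |B IHB C IHC|B IHB C IHC|B IHB C IHC|B IHB];
      cbn [encode forces]; intros HB [w [Hw HW]]; cbn [proj1_sig].
    - reflexivity.
    - apply (bit_lt _ _ _ HX) in HB. split; [contradiction|].
      intros Hbot. specialize (Hloc w Hw HW 0 ltac:(lia) 0 ltac:(lia)).
      apply local_truth_spec in Hloc. tauto.
    - pose proof (L2 w Hw HW _ _ _ HB) as L.
      apply local_truth_spec in L as (_ & L & _).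
      destruct (L HB) as (XB & XC & ->).
      rewrite IHB, IHC by assumption. reflexivity.
    - pose proof (L2 w Hw HW _ _ _ HB) as L.
      apply local_truth_spec in L as (_ & _ & L & _).
      destruct (L HB) as (XB & XC & ->).
      rewrite IHB, IHC by assumption. reflexivity.
    - pose proof (L2 w Hw HW _ _ _ HB) as L.
      apply local_truth_spec in L as (_ & _ & _ & L & _).
      destruct (L HB) as (XB & XC & ->). split.
      + intros F v Hv HWv HS. rewrite sub_spec in HS by assumption.
        specialize (F (exist _ v (conj Hv HWv)) HS).
        now rewrite IHB, IHC in F.
      + intros F [v [Hv HWv]] HS. rewrite IHB, IHC by assumption.
        apply F; auto. now apply sub_spec.
    (* The box clause speaks of [b] alone; 0 is a dummy value for [c] within the bound. *)
    - assert (local_truth a X W w (encode B) 0 = true) as L.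
      { apply (bit_lt _ _ _ HX) in HB. pose proof (cpair_le 5 (encode B)).
        apply Hloc; auto; lia. }
      apply local_truth_spec in L as (_ & _ & _ & _ & L).
      destruct (L HB) as (XB & ->). split.
      + intros F v Hv HWv HS.
        specialize (F (exist _ v (conj Hv HWv)) HS). now rewrite IHB in F.
      + intros F [v [Hv HWv]] HS. rewrite IHB by assumption. now apply F. }
  intros Hp. apply HA.
  apply (truth A HXA (exist _ w0 (conj Hw0 HW0))).
  apply LC_sound; auto.
  - intros w i. auto.
  - intros u v w H1 H2 i Hi. auto.
  - intros w v H. now apply HR.
  - intros u v w H1 H2. apply HR in H2 as (H2 & H3 & b & H4 & H5).
    apply HR. repeat split; eauto.
    + intros i Hi. auto.
    (* A boxed formula missing from [v] is also missing from the smaller [u]. *)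
    + exists b. auto.
  (* Worlds grow strictly as numbers along [R] and stay below [2 ^ S a]. *)
  - apply well_founded_lt_compat with (f := fun w => 2 ^ S a - proj1_sig w).
    intros v w H. apply HR in H as (H1 & _ & b & H2 & H3).
    pose proof (bit_incl_le _ _ H1).
    assert (proj1_sig w <> proj1_sig v) by congruence.
    pose proof (proj1 (proj2_sig v)). lia.
  - intros n w v L. apply L.
Qed.

(** * Completeness: the canonical finite model *)

Definition codes (w : nat) (G : form -> Prop) : Prop :=
  forall i, bit w i <-> exists C, encode C = i /\ G C.

Lemma codes_encode w G C : codes w G -> bit w (encode C) <-> G C.
Proof.
  intros H. rewrite (H (encode C)). split; [|eauto].
  intros (D & E & HD). now apply encode_inj in E as <-.
Qed.

Lemma codes_incl w v G D :
  codes w G -> codes v D ->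
  (forall i, bit w i -> bit v i) <-> (forall C, G C -> D C).
Proof.
  intros Hw Hv. split; intros H.
  - intros C. rewrite <- (codes_encode w), <- (codes_encode v); eauto.
  - intros i. rewrite (Hw i), (Hv i). firstorder.
Qed.

Lemma codes_exist a G :
  (forall C, G C -> encode C <= a) -> exists w, w < 2 ^ S a /\ codes w G.
Proof.
  intros Ha.
  destruct (bit_comprehension (S a) (fun i => exists C, encode C = i /\ G C))
    as (w & Hw & H).
  exists w. split; [assumption|]. intros i. rewrite H.
  split; [tauto|]. intros (C & <- & HC). specialize (Ha C HC).
  split; [lia|eauto].
Qed.

(** [X] is taken to be all codes of formulas up to [a], and [W] all codes of saturated theories;
    local truth is then the truth lemma of the canonical model. *)
Lemma unprovable_countermodel A :
  ~ LC_prov A ->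
  exists X W, X < 2 ^ S (encode A) /\ W < 2 ^ (2 ^ S (encode A)) /\
    countermodel (encode A) X W = true.
Proof.
  set (a := encode A). intros HA.
  destruct (codes_exist a (fun C => encode C <= a)) as (X & HX & CX); [auto|].
  destruct (bit_comprehension (2 ^ S a)
    (fun w => exists G, saturated a G /\ codes w G)) as (W & HW & CW).
  exists X, W. split; [assumption|split; [assumption|]].
  assert (forall G, saturated a G ->
    exists v, v < 2 ^ S a /\ bit W v /\ codes v G) as ex.
  { intros G HG. destruct (codes_exist a G) as (v & Hv & Cv); [apply HG|].
    exists v. split; [assumption|split; [|assumption]].
    apply CW. eauto. }
  apply countermodel_spec. repeat split.
  - now apply (codes_encode X _ A CX).
  - intros w Hw HWw b _ c _. apply CW in HWw as (_ & G & HG & Cw).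
    assert (forall t b c C, encode C = cpair t (cpair b c) ->
      encode C <= a -> b <= a /\ c <= a) as Le.
    { intros t x y C E HC. pose proof (cpair_le t (cpair x y)).
      pose proof (cpair_le x y). lia. }
    assert (forall C, encode C <= a -> bit X (encode C)) as HXi
      by (intros C; apply (codes_encode X _ C CX)).
    apply local_truth_spec. split; [|split; [|split; [|split]]].
    + change (cpair 1 0) with (encode Bot). rewrite codes_encode by eassumption.
      now apply saturated_bot with a.
    (* Each bit of [X] is the code of an actual formula, and the tag 2 forces a conjunction; the
       other connectives are read off in the same way. *)
    + intros HB. apply CX in HB as (E & EE & HE).
      destruct (Le _ _ _ _ EE HE) as [Lb Lc].
      destruct E as [| |B C| | |]; cbn in EE;
        apply cpair_inj in EE as [Et EE]; try discriminate.
      apply cpair_inj in EE as [<- <-].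
      split; [auto|split; [auto|]].
      change (cpair 2 (cpair (encode B) (encode C))) with (encode (And B C)).
      rewrite !(codes_encode w G) by assumption. split.
      * intros H. split; apply (saturated_drv a G); auto;
          (eapply drv_mp; [apply drv_thm|apply drv_hyp, H]); constructor.
      * intros [H1 H2]. apply (saturated_drv a G); auto.
        eapply drv_mp; [|apply drv_hyp, H2].
        eapply drv_mp; [|apply drv_hyp, H1]. apply drv_thm, ax_andI.
    + intros HB. apply CX in HB as (E & EE & HE).
      destruct (Le _ _ _ _ EE HE) as [Lb Lc].
      destruct E as [| | |B C| |]; cbn in EE;
        apply cpair_inj in EE as [Et EE]; try discriminate.
      apply cpair_inj in EE as [<- <-].
      split; [auto|split; [auto|]].
      change (cpair 3 (cpair (encode B) (encode C))) with (encode (Or B C)).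
      rewrite !(codes_encode w G) by assumption. split.
      * now apply saturated_or with a.
      * intros [H|H]; apply (saturated_drv a G); auto;
          (eapply drv_mp; [apply drv_thm|apply drv_hyp, H]); constructor.
    + intros HB. apply CX in HB as (E & EE & HE).
      destruct (Le _ _ _ _ EE HE) as [Lb Lc].
      destruct E as [| | | |B C|]; cbn in EE;
        apply cpair_inj in EE as [Et EE]; try discriminate.
      apply cpair_inj in EE as [<- <-].
      split; [auto|split; [auto|]].
      change (cpair 4 (cpair (encode B) (encode C))) with (encode (Imp B C)).
      rewrite codes_encode by eassumption. split.
      * intros H v Hv HWv HS. apply CW in HWv as (_ & D & HD & Cv).
        rewrite sub_spec in HS by assumption.
        rewrite codes_incl in HS by eassumption.
        rewrite !(codes_encode v D) by assumption.
        intros HBv. apply (saturated_drv a D); auto.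
        eapply drv_mp; apply drv_hyp; eauto.
      * intros H. apply NNPP. intros N.
        destruct (saturated_imp a G B C) as (D & HD & GD & DB & DC); auto.
        destruct (ex D HD) as (v & Hv & HWv & Cv). apply DC.
        apply (codes_encode v); [assumption|]. apply H; auto.
        -- apply sub_spec; [assumption|]. now apply (codes_incl w v G D).
        -- now apply (codes_encode v D).
    + intros HB. apply CX in HB as (E & EE & HE).
      assert (b <= a) as Lb by (pose proof (cpair_le 5 b); lia).
      destruct E as [| | | | |B]; cbn in EE;
        apply cpair_inj in EE as [Et EE]; try discriminate. subst b.
      split; [auto|].
      change (cpair 5 (encode B)) with (encode (Box B)).
      rewrite codes_encode by eassumption. split.
      * intros H v Hv HWv HS. rewrite acc_spec in HS by assumption.
        destruct HS as (_ & HS & _).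
        apply HS. now apply (codes_encode w G (Box B)).
      * intros H. apply NNPP. intros N.
        destruct (saturated_box a G B) as (D & HD & GD & GD' & DB & DN); auto.
        { intros C. pose proof (cpair_le 5 (encode C)). cbn. lia. }
        destruct (ex D HD) as (v & Hv & HWv & Cv). apply DN.
        apply (codes_encode v); [assumption|]. apply H; auto.
        apply acc_spec; auto. split; [|split].
        -- now apply (codes_incl w v G D).
        (* A bit of [w] with tag 5 can only come from a boxed formula in [G]. *)
        -- intros b Hb. apply Cw in Hb as (C & EC & HC).
           destruct C; cbn in EC; apply cpair_inj in EC as [Et' EC];
             try discriminate. subst b.
           apply (codes_encode v D); auto.
        (* [Box B] was put into [D] and is absent from [G], so the step is strict. *)
        -- exists (encode B). split.
           ++ now apply (codes_encode v D (Box B)).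
           ++ now rewrite (codes_encode w G (Box B)).
  (* Since [A] is unprovable, the empty theory extends to a world omitting [A]. *)
  - destruct (lindenbaum a (fun _ => False) A) as (G & HG & _ & NG).
    + contradiction.
    + contradict HA. now apply drv_closed.
    + destruct (ex G HG) as (w & Hw & HWw & Cw).
      exists w. split; [assumption|split; [assumption|]].
      unfold a. rewrite codes_encode by eassumption.
      contradict NG. now apply drv_hyp.
Qed.

Lemma refutable_unprovable A : refutable (encode A) = true <-> ~ LC_prov A.
Proof.
  rewrite refutable_spec. split.
  - intros (X & W & HX & _ & H). eauto using countermodel_unprovable.
  - apply unprovable_countermodel.
Qed.

Theorem theorem4p26 : decidable_form LC_prov.
Proof.
  (* The decision program negates the refutation search; excluded middle enters only the proof of
     its correctness. *)
  destruct (compb_negb 1 _ compb_refutable) as [p Hp].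
  exists p. intros A. specialize (Hp [encode A] eq_refl). cbn [hd] in Hp.
  pose proof (refutable_unprovable A).
  destruct (refutable (encode A)); cbn in Hp; split; intros; try assumption.
  - tauto.
  - enough (false = true) by discriminate. tauto.
Qed.
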